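(* Let $X\in\mathbb{R}^n$ and $Y=GX+\epsilon\in\mathbb{R}^m$ be jointly Gaussian, where $G\in\mathbb{R}^{m\times n}$, $X\sim\mathcal{N}(0,\Gamma_X)$ and $\epsilon\sim\mathcal{N}(0,\Gamma_{Y|X})$ are independent, and $\Gamma_X,\Gamma_{Y|X}$ are positive definite; let $\Gamma_Y=G\Gamma_XG^\top+\Gamma_{Y|X}$. Let $\mathscr{V}=\{1,\dots,m\}$ and let $F:2^{\mathscr{V}}\to\mathbb{R}$ be $F(\mathscr{A})=\mathcal{I}(X;Y_{\mathscr{A}})$, the mutual information between $X$ and the subvector $Y_{\mathscr{A}}=(Y_i)_{i\in\mathscr{A}}$ (with $F(\emptyset)=0$). Let $\zeta_{\min}$ and $\zeta_{\max}$ be the smallest and largest generalized eigenvalues of the pair $(\Gamma_Y,\Gamma_{Y|X})$, and suppose $\zeta_{\max}>1$. Then the submodularity ratio $\gamma$ and the supermodularity ratio $\eta$ of $F$ satisfy $$\gamma\ \ge\ \frac{\log\zeta_{\min}}{\log\zeta_{\max}}\qquad\text{and}\qquad\eta\ \ge\ \frac{\log\zeta_{\min}}{\log\zeta_{\max}}.$$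
   Context: The generalized eigenvalues of a pair $(A,B)$ of symmetric matrices with $B$ positive definite are the scalars $\zeta$ with $Au=\zeta Bu$ for some $u\ne0$. In this setting $\mathcal{I}(X;Y_{\mathscr{A}})=\frac12\log\frac{\det\Gamma_{Y_{\mathscr{A}}}}{\det\Gamma_{Y_{\mathscr{A}}|X}}$, where $\Gamma_{Y_{\mathscr{A}}}$ and $\Gamma_{Y_{\mathscr{A}}|X}$ are the principal submatrices of $\Gamma_Y$ and $\Gamma_{Y|X}$ indexed by $\mathscr{A}$. Incremental gain: $\rho_{\mathscr{A}}(\mathscr{B})=F(\mathscr{A}\cup\mathscr{B})-F(\mathscr{B})$, $\rho_\nu(\mathscr{B})=\rho_{\{\nu\}}(\mathscr{B})$. The submodularity ratio $\gamma$ is the largest scalar with $\sum_{\nu\in\mathscr{A}\setminus\mathscr{B}}\rho_\nu(\mathscr{B})\ge\gamma\,\rho_{\mathscr{A}}(\mathscr{B})$ for all $\mathscr{A},\mathscr{B}\subseteq\mathscr{V}$. The supermodularity ratio $\eta$ is the largest scalar with $\rho_{\mathscr{A}}(\mathscr{B})\ge\eta\sum_{\nu\in\mathscr{A}\setminus\mathscr{B}}\rho_\nu(\mathscr{B})$ for all $\mathscr{A},\mathscr{B}\subseteq\mathscr{V}$. *)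

(* Defs.v *)
From HB Require Import structures.
From mathcomp Require Import all_boot all_order all_algebra.
From mathcomp Require Import classical_sets reals exp.

Set Implicit Arguments.
Unset Strict Implicit.
Unset Printing Implicit Defensive.

Import Order.TTheory GRing.Theory Num.Theory.

Local Open Scope ring_scope.

Section Extremal.
Variable R : realType.

Definition is_greatest (S : set R) (x : R) : Prop := S x /\ ubound S x.

Definition is_least (S : set R) (x : R) : Prop := S x /\ lbound S x.

End Extremal.

Section SymmetricMatrices.
Variable R : realType.

Definition posdefmx n (M : 'M[R]_n) : Prop :=
  M^T = M /\ forall u : 'cV[R]_n, u != 0 -> 0 < (u^T *m M *m u) 0 0.

Definition principal_submx m (M : 'M[R]_m) (A : {set 'I_m}) : 'M[R]_#|A| :=
  mxsub enum_val enum_val M.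

Definition gen_eigenvalues m (M N : 'M[R]_m) : set R :=
  [set z : R | exists2 u : 'cV[R]_m, u != 0 & M *m u = z *: (N *m u)]%classic.

End SymmetricMatrices.

(* [T] is the ground set; set functions take real values. *)
Section SetFunctions.
Variables (R : realType) (T : finType).
Implicit Types (F : {set T} -> R) (A B : {set T}).

Definition gain F A B : R := F (A :|: B) - F B.

Definition submodularity_ratio F : R -> Prop :=
  is_greatest [set g : R | forall A B,
    g * gain F A B <= \sum_(v in A :\: B) gain F [set v] B]%classic.

Definition supermodularity_ratio F : R -> Prop :=
  is_greatest [set h : R | forall A B,
    h * \sum_(v in A :\: B) gain F [set v] B <= gain F A B]%classic.

End SetFunctions.

(* The model is Y = G X + eps with X ~ N(0, GammaX) and eps ~ N(0, GammaYX)
   independent, so that GammaYX is the conditional covariance of Y given X. *)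
Section LinearGaussianModel.
Variables (R : realType) (m n : nat).
Variables (G : 'M[R]_(m, n)) (GammaX : 'M[R]_n) (GammaYX : 'M[R]_m).

Definition marginal_cov : 'M[R]_m := G *m GammaX *m G^T + GammaYX.

(* The mutual information I(X; Y_A) of jointly Gaussian vectors, in nats,
   through the covariance of Y_A and its conditional covariance given X.
   For A = set0 both determinants are those of 0 x 0 matrices, so that the
   value is ln 1 / 2 = 0. *)
Definition mutual_information (A : {set 'I_m}) : R :=
  2^-1 * ln (\det (principal_submx marginal_cov A) /
             \det (principal_submx GammaYX A)).

End LinearGaussianModel.

(* Main.v *)
Require Import Defs.
From HB Require Import structures.
From mathcomp Require Import all_boot all_order all_fingroup all_algebra.
From mathcomp Require Import classical_sets reals exp.
From mathcomp Require Import ring lra.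

(** Write [S] for the covariance of Y and [D] for its conditional covariance given
X. The marginal gain F(B + v) - F(B) is half the logarithm of a quotient of two
Schur complements, those of [B] in the submatrices of [S] and of [D] on B + v.
The Schur complement is the minimum of the quadratic form over the vectors
supported on B + v whose entry at v is 1 ([corner_ratio_le],
[corner_ratio_attained]). The extreme generalized eigenvalues give
[zmin * D <= S <= zmax * D] as quadratic forms ([least_gen_eigenvalue_bound],
[greatest_gen_eigenvalue_bound]), and this passes to the minima. Hence each
marginal gain lies in the interval from [c = ln zmin / 2] to [d = ln zmax / 2]
([gain_mutual_information_bounds]).

By telescoping, the gain of a set A over B and the sum of the marginal gains of
its elements both lie between [c k] and [d k], with [k] the number of elements of
A outside B. As [zmin >= 1], [c] is nonnegative, and each of the two quantities is
at least [c / d] times the other ([ratios_ge]).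

The greatest admissible scalars exist because some constraint bounds them from
above: since [zmax > 1], the matrix [S - D] is semidefinite and nonzero, so it has
a positive diagonal entry and some single observation carries information
([mutual_information1_gt0]).

The Rayleigh bounds are obtained from the order completeness of the reals: the top
generalized eigenvalue is the infimum of the [t] with [t * D - S] semidefinite
([exists_top_gen_eigenvalue]). *)

Set Implicit Arguments.
Unset Strict Implicit.
Unset Printing Implicit Defensive.

Import Order.TTheory GRing.Theory Num.Theory.

Local Open Scope ring_scope.

(** * Positive semidefinite bilinear forms *)

Section BilinearForm.
Variable R : realType.

Definition bform n (M : 'M[R]_n) (u v : 'cV[R]_n) : R := (u^T *m M *m v) 0 0.

Definition psdmx n (M : 'M[R]_n) : Prop :=
  M^T = M /\ forall u, 0 <= bform M u u.

Lemma bformDl n (M : 'M[R]_n) u v w :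
  bform M (u + v) w = bform M u w + bform M v w.
Proof. by rewrite /bform linearD /= !mulmxDl mxE. Qed.

Lemma bformDr n (M : 'M[R]_n) u v w :
  bform M w (u + v) = bform M w u + bform M w v.
Proof. by rewrite /bform mulmxDr mxE. Qed.

Lemma bformZl n (M : 'M[R]_n) a u w : bform M (a *: u) w = a * bform M u w.
Proof. by rewrite /bform linearZ /= -!scalemxAl mxE. Qed.

Lemma bformZr n (M : 'M[R]_n) a u w : bform M w (a *: u) = a * bform M w u.
Proof. by rewrite /bform -!scalemxAr mxE. Qed.

Lemma bformMD n (M N : 'M[R]_n) u v : bform (M + N) u v = bform M u v + bform N u v.
Proof. by rewrite /bform mulmxDr mulmxDl mxE. Qed.

Lemma bformMN n (M : 'M[R]_n) u v : bform (- M) u v = - bform M u v.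
Proof. by rewrite /bform mulmxN mulNmx mxE. Qed.

Lemma bformMZ n a (M : 'M[R]_n) u v : bform (a *: M) u v = a * bform M u v.
Proof. by rewrite /bform -scalemxAr -scalemxAl mxE. Qed.

Lemma bform_tr n (M : 'M[R]_n) u v : bform M u v = bform M^T v u.
Proof.
rewrite /bform; have -> : v^T *m M^T *m u = (u^T *m M *m v)^T.
  by rewrite !trmx_mul trmxK mulmxA.
by rewrite [in RHS]mxE.
Qed.

Lemma bformC n (M : 'M[R]_n) u v : M^T = M -> bform M u v = bform M v u.
Proof. by move=> sM; rewrite bform_tr sM. Qed.

Lemma bform_congr m n (S : 'M[R]_m) (E : 'M[R]_(m, n)) u v :
  bform (E^T *m S *m E) u v = bform S (E *m u) (E *m v).
Proof. by rewrite /bform trmx_mul !mulmxA. Qed.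

Lemma bform_entry n (M : 'M[R]_n) i j :
  bform M (delta_mx i 0) (delta_mx j 0) = M i j.
Proof. by rewrite /bform trmx_delta -rowE -colE !mxE. Qed.

Lemma bform_delta n (M : 'M[R]_n) i u : bform M (delta_mx i 0) u = (M *m u) i 0.
Proof. by rewrite /bform trmx_delta -mulmxA -rowE mxE. Qed.

Lemma posdef_psd n (M : 'M[R]_n) : posdefmx M -> psdmx M.
Proof.
move=> [sM pM]; split=> // u; have [->|u0] := eqVneq u 0.
  by rewrite /bform mulmx0 mxE.
exact: ltW (pM u u0).
Qed.

(** The quadratic form is nonnegative on the plane spanned by [u] and [v], so its
discriminant there has the right sign. A null vector [v] needs a separate argument,
the discriminant being taken in the variable multiplying [v]. *)
Lemma psd_cauchy_schwarz n (M : 'M[R]_n) u v : psdmx M ->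
  bform M u v ^+ 2 <= bform M u u * bform M v v.
Proof.
move=> [sM pM].
have pos s t : 0 <= s ^+ 2 * bform M u u + 2 * s * t * bform M u v
                    + t ^+ 2 * bform M v v.
  have := pM (s *: u + t *: v).
  rewrite !(bformDl, bformDr, bformZl, bformZr) (bformC v u sM); lra.
have := pM u; have := pM v.
set a := bform M u u in pos *; set b := bform M u v in pos *.
set c := bform M v v in pos * => c0 a0.
have [c_eq0|cn0] := eqVneq c 0.
  have [-> | bn0] := eqVneq b 0; first by rewrite c_eq0 expr0n mulr0.
  (* with c = 0 the form is affine in t, so that it would take the value -1 *)
  have := pos 1 (- (a + 1) / (2 * b)).
  have -> : 1 ^+ 2 * a + 2 * 1 * (- (a + 1) / (2 * b)) * b
     + (- (a + 1) / (2 * b)) ^+ 2 * c = -1 by rewrite c_eq0; field.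
  by rewrite lerNr oppr0 ler10.
have cp : 0 < c by rewrite lt_neqAle eq_sym cn0.
have := pos c (- b).
have -> : c ^+ 2 * a + 2 * c * - b * b + (- b) ^+ 2 * c = c * (a * c - b ^+ 2).
  by ring.
by rewrite pmulr_rge0 // subr_ge0.
Qed.

(** By Cauchy-Schwarz an isotropic vector is orthogonal to every vector. *)
Lemma psd_isotropic n (M : 'M[R]_n) u : psdmx M ->
  bform M u u = 0 -> M *m u = 0.
Proof.
move=> psdM u0; apply/matrixP=> i j; rewrite ord1 -bform_delta [RHS]mxE.
apply/eqP; rewrite -sqrf_eq0 eq_le sqr_ge0 andbT.
by have := psd_cauchy_schwarz (delta_mx i 0) u psdM; rewrite u0 mulr0.
Qed.

Lemma posdef_unitmx n (M : 'M[R]_n) : posdefmx M -> M \in unitmx.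
Proof.
move=> [sM pM]; rewrite unitmxE unitfE; apply/det0P => -[v v0 vM].
have vt0 : v^T != 0 by rewrite -(inj_eq (@trmx_inj _ _ _)) trmxK trmx0.
by have := pM _ vt0; rewrite trmxK vM mul0mx mxE ltxx.
Qed.

Lemma psd_unit_posdef n (M : 'M[R]_n) : psdmx M -> M \in unitmx -> posdefmx M.
Proof.
move=> psdM uM; have [sM pM] := psdM; split=> // u un0.
rewrite lt_neqAle eq_sym (pM u) andbT; apply: contraNneq un0 => u0.
by rewrite -(mulKmx uM u) (psd_isotropic psdM u0) mulmx0.
Qed.

Lemma posdef_inv n (M : 'M[R]_n) : posdefmx M -> posdefmx (invmx M).
Proof.
move=> pdM; have [sM pM] := pdM; have uM := posdef_unitmx pdM.
have sI : (invmx M)^T = invmx M by rewrite trmx_inv sM.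
split=> // u u0; have Iu0 : invmx M *m u != 0.
  by apply: contraNneq u0 => Iu0; rewrite -(mulKVmx uM u) Iu0 mulmx0.
by have := pM _ Iu0; rewrite trmx_mul sI mulmxKV // mulmxA.
Qed.

Lemma bform_le_dot n (M : 'M[R]_n) : exists2 K : R, 0 <= K &
  forall u, bform M u u <= K * bform 1%:M u u.
Proof.
exists (\sum_i \sum_j `|M i j|); first by do 2!apply: sumr_ge0 => ? _.
have dotE (u : 'cV[R]_n) : bform 1%:M u u = \sum_i u i 0 ^+ 2.
  by rewrite /bform mulmx1 mxE; apply: eq_bigr => i _; rewrite mxE expr2.
have sq_le (u : 'cV[R]_n) i : u i 0 ^+ 2 <= bform 1%:M u u.
  rewrite dotE (bigD1 i) //= lerDl; apply: sumr_ge0 => j _; exact: sqr_ge0.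
move=> u; rewrite [leLHS]/bform mxE; under eq_bigr => j _ do rewrite mxE mulr_suml.
rewrite exchange_big mulr_suml ler_sum // => i _.
rewrite mulr_suml ler_sum // => j _; rewrite mxE.
apply: le_trans (ler_norm _) _; rewrite mulrAC normrM mulrC ler_wpM2l //.
rewrite normrM; have := sq_le u i; have := sq_le u j.
rewrite -(real_normK (num_real (u i 0))) -(real_normK (num_real (u j 0))).
have := sqr_ge0 (`|u i 0| - `|u j 0|); lra.
Qed.

(** Any quadratic form is bounded by a multiple of a positive definite one.
A coercivity bound for [P] comes without eigenvalues or compactness, from
Cauchy-Schwarz applied to [u] and [P^-1 u]:
|u|^4 = (u^T P P^-1 u)^2 <= (u^T P u) (u^T P^-1 u) <= (u^T P u) C |u|^2. *)
Lemma posdef_dominates n (P N : 'M[R]_n) : posdefmx P -> exists2 K : R, 0 <= K &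
  forall u, bform N u u <= K * bform P u u.
Proof.
move=> pdP; have uP := posdef_unitmx pdP; have psdP := posdef_psd pdP.
have [C C0 leC] := bform_le_dot (invmx P).
have [D D0 leD] := bform_le_dot N.
exists (D * C) => [|u]; first exact: mulr_ge0.
apply: le_trans (leD u) _; rewrite -mulrA ler_wpM2l //.
set d := bform 1%:M u u.
have d0 : 0 <= d.
  by rewrite /d /bform mulmx1 mxE sumr_ge0 // => i _; rewrite mxE -expr2 sqr_ge0.
have [->|dn0] := eqVneq d 0; first by rewrite mulr_ge0 // psdP.2.
have dp : 0 < d by rewrite lt_neqAle eq_sym dn0.
have := psd_cauchy_schwarz u (invmx P *m u) psdP.
have -> : bform P u (invmx P *m u) = d by rewrite /d /bform !mulmxA mulmxK ?mulmx1.
have -> : bform P (invmx P *m u) (invmx P *m u) = bform (invmx P) u u.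
  rewrite -bform_congr trmx_inv psdP.1 mulVmx // mul1mx //.
move=> cs; rewrite -(ler_pM2l dp) -expr2; apply: le_trans cs _.
have -> : d * (C * bform P u u) = bform P u u * (C * d) by ring.
by rewrite ler_wpM2l // psdP.2.
Qed.

End BilinearForm.

(** * Rayleigh bounds from extreme generalized eigenvalues *)

Section RayleighBounds.
Variable R : realType.

(** The eigenvalue is the least [t] for which [t N - M] is positive
semidefinite. At that [t] the matrix must be singular: otherwise it would be
positive definite, hence dominate a multiple of [N], and [t] could be lowered.
A kernel vector is an eigenvector. The vector [w] only witnesses that the
dimension is positive, without which the infimum would not exist. *)
Lemma exists_top_gen_eigenvalue n (M N : 'M[R]_n) (w : 'cV[R]_n) :
  M^T = M -> posdefmx N -> w != 0 ->
  exists2 t : R, gen_eigenvalues M N t &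
    forall u, bform M u u <= t * bform N u u.
Proof.
move=> sM pdN w0; have [sN pN] := pdN.
pose E := [set t : R | forall u, bform M u u <= t * bform N u u]%classic.
have E0 : (E !=set0)%classic by have [K _ leK] := posdef_dominates M pdN; exists K.
have lbE u : u != 0 -> lbound E (bform M u u / bform N u u).
  by move=> u0 t Et; rewrite ler_pdivrMr ?pN //; exact: Et.
have infE : E (inf E).
  move=> u; have [->|u0] := eqVneq u 0; first by rewrite /bform !mulmx0 mxE mulr0.
  by rewrite -ler_pdivrMr ?pN //; apply: lb_le_inf => //; exact: lbE.
exists (inf E) => //; pose P := inf E *: N - M.
have bP u : bform P u u = inf E * bform N u u - bform M u u.
  by rewrite bformMD bformMZ bformMN.
have psdP : psdmx P.
  split=> [|u]; last by rewrite bP subr_ge0; exact: infE.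
  by rewrite linearB linearZ /= sM sN.
have: P \notin unitmx.
  apply/negP => /(psd_unit_posdef psdP) pdP.
  have [K K0 leK] := posdef_dominates N pdP.
  have Kp : 0 < K + 1 by rewrite ltr_wpDl.
  suff: E (inf E - (K + 1)^-1).
    move=> /(ge_inf (ex_intro _ _ (lbE w w0))).
    by rewrite lerBDr gerDl leNgt invr_gt0 Kp.
  move=> u; have := leK u; rewrite bP mulrBl => leu.
  have Nu : (K + 1)^-1 * bform N u u <= inf E * bform N u u - bform M u u.
    rewrite mulrC ler_pdivrMr // mulrDr mulr1 mulrC; apply: le_trans leu _.
    by rewrite lerDl -bP psdP.2.
  lra.
rewrite unitmxE unitfE negbK => /det0P [v v0 vP].
exists v^T; first by rewrite -(inj_eq (@trmx_inj _ _ _)) trmxK trmx0.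
apply/eqP; rewrite eq_sym -subr_eq0 scalemxAl -mulmxBl -/P.
by rewrite -(inj_eq (@trmx_inj _ _ _)) trmx_mul trmxK psdP.1 vP trmx0.
Qed.

Lemma greatest_gen_eigenvalue_bound n (M N : 'M[R]_n) z :
  M^T = M -> posdefmx N -> is_greatest (gen_eigenvalues M N) z ->
  forall u, bform M u u <= z * bform N u u.
Proof.
move=> sM pdN [[w w0 _] ubz] u.
have [t /ubz tz leM] := exists_top_gen_eigenvalue sM pdN w0.
by apply: le_trans (leM u) _; rewrite ler_wpM2r ?(posdef_psd pdN).2.
Qed.

Lemma least_gen_eigenvalue_bound n (M N : 'M[R]_n) z :
  M^T = M -> posdefmx N -> is_least (gen_eigenvalues M N) z ->
  forall u, z * bform N u u <= bform M u u.
Proof.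
move=> sM pdN [[w w0 ev] lbz] u.
have ubNz : is_greatest (gen_eigenvalues (- M) N) (- z).
  split=> [|t [v v0 tv]]; first by exists w; rewrite // mulNmx ev scaleNr.
  rewrite lerNr; apply: lbz; exists v => //.
  by rewrite scaleNr -tv mulNmx opprK.
have sNM : (- M)^T = - M by rewrite linearN /= sM.
have := greatest_gen_eigenvalue_bound sNM pdN ubNz u.
by rewrite bformMN mulNr lerN2.
Qed.

End RayleighBounds.

(** * Determinants of principal submatrices *)

Section Determinants.
Variable R : realType.

(** For injective [f] the matrix [colsub f 1%:M] extends a vector by zero outside
the range of [f], so that principal submatrices inherit definiteness and
inequalities between quadratic forms. *)
Lemma mxsub_congr m k (S : 'M[R]_m) (f : 'I_k -> 'I_m) :
  mxsub f f S = (colsub f 1%:M)^T *m S *m colsub f 1%:M.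
Proof.
by rewrite trmx_mxsub trmx1 mulmx_colsub mulmx1 -rowsubE -mxsub_comp.
Qed.

Lemma bform_mxsub m k (S : 'M[R]_m) (f : 'I_k -> 'I_m) u :
  bform (mxsub f f S) u u =
  bform S (colsub f 1%:M *m u) (colsub f 1%:M *m u).
Proof. by rewrite mxsub_congr bform_congr. Qed.

Lemma posdef_mxsub m k (S : 'M[R]_m) (f : 'I_k -> 'I_m) :
  injective f -> posdefmx S -> posdefmx (mxsub f f S).
Proof.
move=> injf [sS pS]; split; first by rewrite trmx_mxsub sS.
move=> u u0; rewrite -/(bform _ _ _) bform_mxsub; apply: pS.
apply: contraNneq u0 => Eu0; apply/eqP.
rewrite -[u]mul1mx.
have -> : 1%:M = rowsub f (colsub f 1%:M) :> 'M[R]_k.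
  by apply/matrixP=> i j; rewrite !mxE (inj_eq injf).
by rewrite mul_rowsub_mx Eu0; apply/matrixP=> i j; rewrite !mxE.
Qed.

Lemma invmx_corner k (T : 'M[R]_k.+1) :
  T \in unitmx -> invmx T 0 0 = \det (row' 0 (col' 0 T)) / \det T.
Proof. by move=> uT; rewrite /invmx uT !mxE /cofactor mul1r mulrC. Qed.

Lemma invmx_corner_gt0 k (T : 'M[R]_k.+1) : posdefmx T -> 0 < invmx T 0 0.
Proof.
move=> pdT; rewrite -bform_entry; apply: (posdef_inv pdT).2.
by apply/negP => /eqP/matrixP/(_ 0 0)/eqP; rewrite !mxE oner_eq0.
Qed.

Lemma posdef_corner k (T : 'M[R]_k.+1) :
  posdefmx T -> posdefmx (row' 0 (col' 0 T)).
Proof.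
rewrite row'Esub col'Esub -mxsub_comp; apply: posdef_mxsub; exact: lift_inj.
Qed.

Lemma posdef_det_gt0 k (T : 'M[R]_k) : posdefmx T -> 0 < \det T.
Proof.
elim: k T => [|k IHk] T pdT; first by rewrite det_mx00.
have uT := posdef_unitmx pdT; have := IHk _ (posdef_corner pdT).
have := invmx_corner_gt0 pdT.
by rewrite invmx_corner // => q p; rewrite pmulr_rgt0 // invr_gt0 in q.
Qed.

Lemma bform_invmx k (T : 'M[R]_k) u v :
  posdefmx T -> bform T (invmx T *m u) (invmx T *m v) = bform (invmx T) u v.
Proof.
move=> pdT; have uT := posdef_unitmx pdT.
by rewrite -bform_congr trmx_inv pdT.1 mulVmx // mul1mx.
Qed.

Lemma corner_ratioE k (T : 'M[R]_k.+1) : posdefmx T ->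
  \det T / \det (row' 0 (col' 0 T)) = (invmx T 0 0)^-1.
Proof. by move=> /posdef_unitmx uT; rewrite invmx_corner // invf_div. Qed.

(** The ratio on the left is the Schur complement of the corner, that is, the
conditional variance of the first variable given the others, and so the minimum
of the quadratic form over vectors with first entry 1. The minimum is attained
at the normalized first column of [T^-1]; Cauchy-Schwarz against that column
gives the lower bound. *)
Lemma corner_ratio_le k (T : 'M[R]_k.+1) (u : 'cV[R]_k.+1) :
  posdefmx T -> u 0 0 = 1 ->
  \det T / \det (row' 0 (col' 0 T)) <= bform T u u.
Proof.
move=> pdT u1; have uT := posdef_unitmx pdT.
have := psd_cauchy_schwarz u (invmx T *m delta_mx 0 0) (posdef_psd pdT).
rewrite bform_invmx // bform_entry.
have -> : bform T u (invmx T *m delta_mx 0 0) = 1.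
  by rewrite /bform !mulmxA mulmxK // -colE !mxE u1.
rewrite expr1n corner_ratioE // => cs.
by rewrite -[leLHS]mul1r ler_pdivrMr // invmx_corner_gt0.
Qed.

Lemma corner_ratio_attained k (T : 'M[R]_k.+1) : posdefmx T ->
  exists2 u : 'cV[R]_k.+1, u 0 0 = 1 &
    bform T u u = \det T / \det (row' 0 (col' 0 T)).
Proof.
move=> pdT; have t0 : invmx T 0 0 != 0 by rewrite gt_eqF // invmx_corner_gt0.
exists ((invmx T 0 0)^-1 *: (invmx T *m delta_mx 0 0)).
  by rewrite -colE !mxE mulVf.
by rewrite bformZl bformZr bform_invmx // bform_entry corner_ratioE // mulVf ?mulr1.
Qed.

(** Both ratios are minima of quadratic forms over the same set of vectors, so
an inequality between the forms passes to the minima. *)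
Lemma corner_ratio_mono k (P Q : 'M[R]_k.+1) c :
  posdefmx P -> posdefmx Q -> (forall u, bform P u u <= c * bform Q u u) ->
  \det P / \det (row' 0 (col' 0 P)) <= c * (\det Q / \det (row' 0 (col' 0 Q))).
Proof.
move=> pdP pdQ PQ; have [u u1 <-] := corner_ratio_attained pdQ.
by apply: le_trans (PQ u); exact: corner_ratio_le.
Qed.

(** [principal_submx] lists the indices of [A] in increasing order. Any other
listing of [A] permutes rows and columns alike, so that the two signs cancel. *)
Lemma det_principal_submxE m k (S : 'M[R]_m) (A : {set 'I_m}) (f : 'I_k -> 'I_m) :
  injective f -> codom f =i A -> \det (principal_submx S A) = \det (mxsub f f S).
Proof.
move=> injf fA; have Ak : #|A| = k by rewrite -(eq_card fA) card_codom // card_ord.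
case: k / Ak f injf fA => f injf fA.
have fAi i : f i \in A by rewrite -fA codom_f.
pose g i : 'I_#|A| := enum_rank_in (fAi i) (f i).
have gK i : enum_val (g i) = f i by exact: enum_rankK_in.
have injg : injective g by move=> i j gij; apply: injf; rewrite -!gK gij.
have -> : mxsub f f S =
    row_perm (perm injg) (col_perm (perm injg) (principal_submx S A)).
  by apply/matrixP=> i j; rewrite !mxE !permE !gK.
rewrite row_permE col_permE !det_mulmx !det_perm mulrCA mulrA.
by rewrite odd_permV -mulrA -signr_addb addbb mulr1.
Qed.

(** Listing [v] first makes the submatrix on [B] the corner of the submatrix on
[v |: B]. *)
Lemma setU1_indexing m (v : 'I_m) (B : {set 'I_m}) : v \notin B ->
  exists f : 'I_#|B|.+1 -> 'I_m,
    [/\ injective f, codom f =i v |: B & f \o lift ord0 =1 enum_val].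
Proof.
move=> vB; pose f (i : 'I_#|B|.+1) :=
  if unlift ord0 i is Some j then enum_val j else v.
have f0 : f ord0 = v by rewrite /f unlift_none.
have fS j : f (lift ord0 j) = enum_val j by rewrite /f liftK.
exists f; split=> // [i j|x].
  case: (unliftP ord0 i) => [i' ->|->]; case: (unliftP ord0 j) => [j' ->|->] //;
    rewrite ?f0 ?fS.
  - by move/enum_val_inj => ->.
  - by move=> e; case/negP: vB; rewrite -e enum_valP.
  - by move=> e; case/negP: vB; rewrite e enum_valP.
rewrite !inE; apply/codomP/orP => [[i ->]|[/eqP->|xB]].
- case: (unliftP ord0 i) => [i' ->|->]; rewrite ?f0 ?fS ?eqxx; last by left.
  by right; exact: enum_valP.
- by exists ord0.
by exists (lift ord0 (enum_rank_in xB x)); rewrite fS enum_rankK_in.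
Qed.

Lemma posdef_principal_submx m (M : 'M[R]_m) A :
  posdefmx M -> posdefmx (principal_submx M A).
Proof. by apply: posdef_mxsub; exact: enum_val_inj. Qed.

Lemma principal_ratio_mono m (M N : 'M[R]_m) c (v : 'I_m) (B : {set 'I_m}) :
  posdefmx M -> posdefmx N -> (forall u, bform M u u <= c * bform N u u) ->
  v \notin B ->
  \det (principal_submx M (v |: B)) / \det (principal_submx M B) <=
  c * (\det (principal_submx N (v |: B)) / \det (principal_submx N B)).
Proof.
move=> pdM pdN MN vB; have [f [injf fB f0]] := setU1_indexing vB.
have cornerE (S : 'M[R]_m) :
    principal_submx S B = row' 0 (col' 0 (mxsub f f S)).
  by rewrite row'Esub col'Esub -!mxsub_comp; apply: esym; exact: eq_mxsub.
rewrite !(det_principal_submxE _ injf fB) !cornerE.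
apply: corner_ratio_mono; try exact: posdef_mxsub.
by move=> u; rewrite !bform_mxsub.
Qed.

End Determinants.

(** * Ratios of set functions with bounded marginal gains *)

Section RatioBounds.
Variable R : realType.

(** A constraint with [0 < a i] is an upper bound [g <= b i / a i], which passes
to the supremum; the other constraints only get weaker as [g] grows. The index
[i0] keeps the supremum finite. *)
Lemma greatest_ratio_exists (I : Type) (a b : I -> R) (r : R) (i0 : I) :
  (forall i, r * a i <= b i) -> 0 < a i0 ->
  exists2 g : R,
    is_greatest [set g : R | forall i, g * a i <= b i]%classic g & r <= g.
Proof.
move=> rS a0; set S := [set g | _]%classic.
have ubS : has_ubound S.
  by exists (b i0 / a i0) => g Sg; rewrite ler_pdivlMr //; exact: Sg.
have Sr : S r by [].
exists (sup S); last exact: ub_le_sup.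
split=> [i|]; last exact: ub_le_sup.
have [ai|ai] := ltP 0 (a i).
  rewrite -ler_pdivlMr //; apply: ge_sup; first by exists r.
  by move=> g Sg; rewrite ler_pdivlMr //; exact: Sg.
by apply: le_trans (rS i); rewrite ler_wnM2r // ub_le_sup.
Qed.

Variable T : finType.
Implicit Types (F : {set T} -> R) (A B : {set T}).

(** Adding the elements of [A :\: B] one at a time makes the gain a telescoping
sum of marginal gains. *)
Lemma gain_bounds F c d :
  (forall v B, v \notin B -> c <= gain F [set v] B <= d) ->
  forall A B, c * #|A :\: B|%:R <= gain F A B <= d * #|A :\: B|%:R.
Proof.
move=> bF A B.
have -> : gain F A B = gain F (A :\: B) B.
  rewrite /gain; congr (F _ - _); apply/setP=> x; rewrite !inE.
  by case: (x \in B); case: (x \in A).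
have: [disjoint A :\: B & B].
  by rewrite finset.disjoints_subset; apply/fintype.subsetP=> x; rewrite !inE => /andP[].
move: (A :\: B) => D; elim: {D}#|D| {-2}D (erefl #|D|) => [|k IHk] D.
  move/eqP; rewrite cards_eq0 => /eqP-> _.
  by rewrite cards0 !mulr0 /gain finset.set0U subrr lexx.
move=> Dk DB; have [x xD] : exists x, x \in D by apply/card_gt0P; rewrite Dk.
have Dxk : #|D :\ x| = k by apply: succn_inj; rewrite -Dk (cardsD1 x D) xD.
have DxB : [disjoint D :\ x & B] by apply: disjointWl DB; exact: subD1set.
have := IHk _ Dxk DxB; rewrite Dxk Dk -natr1 !mulrDr !mulr1.
have xn : x \notin (D :\ x) :|: B.
  by rewrite !inE eqxx /= (disjointFr DB xD).
have := bF x _ xn; rewrite /gain finset.setUA finset.setD1K //; lra.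
Qed.

Lemma sum_gain_bounds F c d :
  (forall v B, v \notin B -> c <= gain F [set v] B <= d) ->
  forall A B, c * #|A :\: B|%:R <= \sum_(v in A :\: B) gain F [set v] B
                <= d * #|A :\: B|%:R.
Proof.
move=> bF A B; rewrite !mulr_natr -!sumr_const.
by apply/andP; split; apply: ler_sum => v; rewrite inE => /andP[vB _];
   have /andP[] := bF v B vB.
Qed.

(** Both the gain of [A] and the sum of marginal gains lie between [c k] and
[d k], where [k] is the cardinality of [A :\: B]; hence each is at least [c / d]
times the other. The sets [A0] and [B0] make the two ratios finite. *)
Lemma ratios_ge F c d A0 B0 :
  0 <= c -> 0 < d ->
  (forall v B, v \notin B -> c <= gain F [set v] B <= d) ->
  0 < gain F A0 B0 -> 0 < \sum_(v in A0 :\: B0) gain F [set v] B0 ->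
  (exists2 g : R, submodularity_ratio F g & c / d <= g) /\
  (exists2 h : R, supermodularity_ratio F h & c / d <= h).
Proof.
move=> c0 d0 bF gain0 sum0.
have cross x y k : x <= d * k -> c * k <= y -> c / d * x <= y.
  move=> xd; apply: le_trans; rewrite mulrAC ler_pdivrMr // -mulrA ler_wpM2l //.
  by rewrite mulrC.
split.
- have [p||g [g1 g2] cg] := @greatest_ratio_exists _ (fun p => gain F p.1 p.2)
    (fun p => \sum_(v in p.1 :\: p.2) gain F [set v] p.2) (c / d) (A0, B0).
  + have /andP[_ h1] := gain_bounds bF p.1 p.2.
    have /andP[h2 _] := sum_gain_bounds bF p.1 p.2.
    exact: cross h1 h2.
  + exact: gain0.
  exists g => //; split=> [A B|h hS]; first exact: (g1 (A, B)).
  by apply: g2 => -[A B]; exact: hS.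
- have [p||g [g1 g2] cg] := @greatest_ratio_exists _
    (fun p => \sum_(v in p.1 :\: p.2) gain F [set v] p.2)
    (fun p => gain F p.1 p.2) (c / d) (A0, B0).
  + have /andP[h1 _] := gain_bounds bF p.1 p.2.
    have /andP[_ h2] := sum_gain_bounds bF p.1 p.2.
    exact: cross h2 h1.
  + exact: sum0.
  exists g => //; split=> [A B|h hS]; first exact: (g1 (A, B)).
  by apply: g2 => -[A B]; exact: hS.
Qed.

End RatioBounds.

(** * Mutual information in the linear Gaussian model *)

Section MutualInformation.
Variable R : realType.

Lemma psd_signal m n (G : 'M[R]_(m, n)) (C : 'M[R]_n) :
  posdefmx C -> psdmx (G *m C *m G^T).
Proof.
move=> /posdef_psd[sC pC]; split; first by rewrite !trmx_mul trmxK sC mulmxA.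
by move=> u; rewrite -[G in G *m C]trmxK bform_congr.
Qed.

(** A positive semidefinite matrix with zero diagonal has isotropic basis vectors,
so it vanishes. *)
Lemma psd_diag_gt0 n (K : 'M[R]_n) u :
  psdmx K -> 0 < bform K u u -> exists i, 0 < K i i.
Proof.
move=> psdK uK; apply/existsP; apply: contraTT uK => /existsPn diagK.
have K0 : K = 0.
  apply/trmx_inj/matrixP=> i j; rewrite trmx0 mxE.
  have Kii : bform K (delta_mx i 0) (delta_mx i 0) = 0.
    apply/eqP; rewrite eq_le psdK.2 andbT bform_entry leNgt; exact: diagK.
  by have /matrixP/(_ j 0) := psd_isotropic psdK Kii; rewrite -colE !mxE.
by rewrite K0 /bform mulmx0 mul0mx mxE ltxx.
Qed.

Lemma marginal_cov_posdef m n (G : 'M[R]_(m, n)) C D :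
  posdefmx C -> posdefmx D -> posdefmx (marginal_cov G C D).
Proof.
move=> pdC [sD pD]; have [sK pK] := psd_signal G pdC.
split=> [|u u0]; first by rewrite linearD /= sK sD.
by rewrite -/(bform _ _ _) bformMD ltr_wpDl //; exact: pD.
Qed.

Lemma mutual_informationE m n (G : 'M[R]_(m, n)) C D A :
  posdefmx C -> posdefmx D ->
  mutual_information G C D A = 2^-1 *
    (ln (\det (principal_submx (marginal_cov G C D) A)) -
     ln (\det (principal_submx D A))).
Proof.
move=> pdC pdD; rewrite /mutual_information ln_div // posrE; apply: posdef_det_gt0;
  apply: posdef_principal_submx => //; exact: marginal_cov_posdef.
Qed.

(** The gain is half the logarithm of the quotient of two conditional variances,
those of Y_v given Y_B under the covariances [S] and [D]. The lower bound is the
upper one with the two covariances exchanged. *)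
Lemma gain_mutual_information_bounds m n (G : 'M[R]_(m, n)) C D a b :
  let S := marginal_cov G C D in
  posdefmx C -> posdefmx D -> 0 < a -> 0 < b ->
  (forall u, a * bform D u u <= bform S u u) ->
  (forall u, bform S u u <= b * bform D u u) ->
  forall v (B : {set 'I_m}), v \notin B ->
  2^-1 * ln a <= gain (mutual_information G C D) [set v] B <= 2^-1 * ln b.
Proof.
move=> S pdC pdD a0 b0 aDS SbD v B vB.
have pdS : posdefmx S by exact: marginal_cov_posdef.
have DS u : bform D u u <= a^-1 * bform S u u by rewrite mulrC ler_pdivlMr // mulrC.
have := principal_ratio_mono pdS pdD SbD vB.
have := principal_ratio_mono pdD pdS DS vB.
rewrite /gain !mutual_informationE // -/S.
have det0 (M : 'M[R]_m) A : posdefmx M -> 0 < \det (principal_submx M A).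
  by move=> pdM; exact/posdef_det_gt0/posdef_principal_submx.
have := det0 _ B pdS; have := det0 _ B pdD.
have := det0 _ (v |: B) pdS; have := det0 _ (v |: B) pdD.
move: (\det _) (\det _) (\det _) (\det _) => sB dB svB dvB dvB0 svB0 dB0 sB0.
rewrite -mulrBr !ler_pM2l ?invr_gt0 ?ltr0n //.
have rd0 : 0 < dvB / dB by rewrite divr_gt0.
have rs0 : 0 < svB / sB by rewrite divr_gt0.
rewrite [_^-1 * _]mulrC ler_pdivlMr // mulrC => lo hi.
rewrite -ler_ln ?posrE ?mulr_gt0 ?invr_gt0 // in lo.
rewrite -ler_ln ?posrE ?mulr_gt0 ?invr_gt0 // in hi.
move: lo hi; rewrite !lnM ?posrE ?invr_gt0 // !lnV ?posrE //; lra.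
Qed.

Lemma mutual_information0 m n (G : 'M[R]_(m, n)) C D :
  mutual_information G C D finset.set0 = 0.
Proof.
have d0 (M : 'M[R]_m) : \det (principal_submx M finset.set0) = 1.
  rewrite /principal_submx; move: enum_val; rewrite cards0 => f; exact: det_mx00.
by rewrite /mutual_information !d0 divr1 ln1 mulr0.
Qed.

Lemma det_principal_submx1 m (M : 'M[R]_m) i :
  \det (principal_submx M [set i]) = M i i.
Proof.
rewrite (@det_principal_submxE _ _ 1 M [set i] (fun=> i)).
- by rewrite det_mx11 mxE.
- by move=> x y _; rewrite !ord1.
move=> x; rewrite inE; apply/codomP/eqP => [[]|->] //; by exists ord0.
Qed.

Lemma mutual_information1_gt0 m n (G : 'M[R]_(m, n)) C D u :
  posdefmx C -> posdefmx D ->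
  bform D u u < bform (marginal_cov G C D) u u ->
  exists i, 0 < mutual_information G C D [set i].
Proof.
move=> pdC pdD; rewrite bformMD ltrDr => /(psd_diag_gt0 (psd_signal G pdC))[i Ki].
exists i; rewrite /mutual_information !det_principal_submx1.
have Di : 0 < D i i.
  by rewrite -det_principal_submx1; exact/posdef_det_gt0/posdef_principal_submx.
by rewrite mulr_gt0 ?invr_gt0 // ln_gt0 // ltr_pdivlMr // mul1r mxE ltrDr.
Qed.

End MutualInformation.

Theorem proposition3p5 (R : realType) (m n : nat)
    (G : 'M[R]_(m, n)) (GammaX : 'M[R]_n) (GammaYX : 'M[R]_m)
    (zmin zmax : R)
    (GammaX_posdef : posdefmx GammaX)
    (GammaYX_posdef : posdefmx GammaYX)
    (zmin_least :
       is_least (gen_eigenvalues (marginal_cov G GammaX GammaYX) GammaYX) zmin)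
    (zmax_greatest :
       is_greatest (gen_eigenvalues (marginal_cov G GammaX GammaYX) GammaYX)
         zmax)
    (zmax_gt1 : 1 < zmax) :
  let F := mutual_information G GammaX GammaYX in
  (exists2 gamma : R,
     submodularity_ratio F gamma & ln zmin / ln zmax <= gamma) /\
  (exists2 eta : R,
     supermodularity_ratio F eta & ln zmin / ln zmax <= eta).
Proof.
move=> F; set S := marginal_cov G GammaX GammaYX.
have eigE z u : S *m u = z *: (GammaYX *m u) -> bform S u u = z * bform GammaYX u u.
  by move=> ev; rewrite /bform -mulmxA ev -scalemxAr mulmxA mxE.
have [sS _] := marginal_cov_posdef G GammaX_posdef GammaYX_posdef.
(* S - GammaYX = G GammaX G^T is semidefinite, so that an eigenvector has
   Rayleigh quotient at least 1 *)
have zmin_ge1 : 1 <= zmin.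
  have [[u u0 /eigE]] := zmin_least; rewrite bformMD => ev _.
  have Du : 0 < bform GammaYX u u by exact: GammaYX_posdef.2.
  rewrite -(ler_pM2r Du) mul1r -ev lerDr; exact: (psd_signal G GammaX_posdef).2.
have zmin_gt0 : 0 < zmin by exact: lt_le_trans zmin_ge1.
have zmax_gt0 : 0 < zmax by exact: lt_trans zmax_gt1.
have lnmax : 0 < ln zmax by exact: ln_gt0.
have bF := gain_mutual_information_bounds GammaX_posdef GammaYX_posdef
  zmin_gt0 zmax_gt0
  (least_gen_eigenvalue_bound sS GammaYX_posdef zmin_least)
  (greatest_gen_eigenvalue_bound sS GammaYX_posdef zmax_greatest).
(* some single observation is informative, so that the constraints for
   A = {i} and the empty set bound both ratios *)
have [i Fi] : exists i, 0 < F [set i].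
  have [[u u0 /eigE ev] _] := zmax_greatest.
  apply: (@mutual_information1_gt0 _ _ _ _ _ _ u) => //.
  by rewrite ev ltr_pMl //; exact: GammaYX_posdef.2.
have gain_i : gain F [set i] finset.set0 = F [set i].
  by rewrite /gain finset.setU0 [F finset.set0]mutual_information0 subr0.
have -> : ln zmin / ln zmax = (2^-1 * ln zmin) / (2^-1 * ln zmax).
  by rewrite -mulf_div divff ?mul1r // invr_eq0 pnatr_eq0.
apply: (@ratios_ge _ _ F _ _ [set i] finset.set0 _ _ bF);
  rewrite ?finset.setD0 ?big_set1 ?gain_i //.
- by rewrite pmulr_rge0 ?invr_gt0 ?ltr0n // ln_ge0.
- by rewrite pmulr_rgt0 ?invr_gt0 ?ltr0n.
Qed.
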